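(* Let $p$ be a prime, $n\ge 1$, $q=p^n$. Let $P(x)\in\mathbb{F}_q[x]$ be a polynomial with additive index $k$ over $\mathbb{F}_q$ and write $P(x)=f(L(x))+M(x)$, where $f\in\mathbb{F}_q[x]$, $L(x),M(x)$ are $p$-linearized polynomials over $\mathbb{F}_q$, $\deg(M)<\deg(L)=p^{n-k}$, and $L$ is monic and divides $x^q-x$. Let $p^e=\frac{p^{n-k}}{\deg(\gcd(L,M))}$ and let $\eta$ be a nontrivial multiplicative character of $\mathbb{F}_q$. Then $$\left|\sum_{x\in\mathbb{F}_q}\eta(P(x))\right|\le p^{\,n-e+\min\{e,\,n/2\}}.$$
   Context: A $p$-linearized polynomial is a polynomial of the form $\sum_{i=0}^m a_i x^{p^i}$ (the zero polynomial is allowed). For $P\in\mathbb{F}_q[x]$ put $P_0(x)=P(x)-P(0)$, let $V$ be the set of $y\in\mathbb{F}_q$ such that $P_0(x+y)-P_0(x)-P_0(y)=0$ in $\mathbb{F}_q[x]$, and set $\mathcal{L}(x)=\prod_{v\in V}(x-v)$, which is a monic $p$-linearized polynomial dividing $x^q-x$. If $\deg(\mathcal{L})=p^{n-k}$, then $P$ is said to have additive index $k$ over $\mathbb{F}_q$. A multiplicative character $\eta$ of $\mathbb{F}_q$ is a homomorphism $\mathbb{F}_q^*\to\mathbb{C}^*$, extended to $\mathbb{F}_q$ by $\eta(0)=0$ for $\eta$ nontrivial. *)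

(* Defs.v *)
From HB Require Import structures.
From mathcomp Require Import all_boot all_order all_algebra.
From mathcomp Require Import complex reals exp.

Set Implicit Arguments.
Unset Strict Implicit.
Unset Printing Implicit Defensive.

Import Order.TTheory GRing.Theory Num.Theory.

Local Open Scope ring_scope.

Definition linearized (F : fieldType) (p : nat) (A : {poly F}) : Prop :=
  exists (m : nat) (a : nat -> F), A = \sum_(i < m.+1) a i *: 'X^(p ^ i).

Section AdditiveIndex.
Variables (F : finFieldType) (P : {poly F}).

Definition centered : {poly F} := P - P.[0]%:P.

Definition additive_set : {set F} :=
  [set y | centered \Po ('X + y%:P) - centered - centered.[y]%:P == 0].

Definition additive_poly : {poly F} := \prod_(v in additive_set) ('X - v%:P).

(* Intended for #|F| = p ^ n; k <= n because subtraction on nat truncates. *)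
Definition has_additive_index (p n k : nat) : Prop :=
  (k <= n)%N /\ size additive_poly = (p ^ (n - k)).+1.

End AdditiveIndex.

(* A character F^* -> C^* is represented by its extension by 0 to all of F;
   eta 1 = 1 follows from multiplicativity and the nonvanishing on F^*. *)
Definition nontrivial_mult_char (F : finFieldType) (C : fieldType)
    (eta : F -> C) : Prop :=
  [/\ eta 0 = 0,
      forall x, x != 0 -> eta x != 0,
      forall x y, x != 0 -> y != 0 -> eta (x * y) = eta x * eta y
    & exists2 x, x != 0 & eta x != 1].

(* Main.v *)
Require Import Defs.
From HB Require Import structures.
From mathcomp Require Import all_boot all_order all_algebra.
From mathcomp Require Import complex reals exp.
From mathcomp Require Import finfield.

Set Implicit Arguments.
Unset Strict Implicit.
Unset Printing Implicit Defensive.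

Import Order.TTheory GRing.Theory Num.Theory.

Local Open Scope ring_scope.
Local Open Scope complex_scope.

(** The sum runs over cosets of the kernel [K] of [L] on the field, whose
    cardinality is [#|K| = p ^ (n - k)] because [L] divides ['X^#|F| - 'X] and
    so has all its roots, simple, in [F]. Moving [x] by [z \in K] leaves
    [f (L x)] alone and adds [M z] to the polynomial. Averaging over [K]
    therefore turns the sum of [eta (P x)] into the sum over [x] of
    [eta (P x + w)], with [w] ranging over the additive subgroup [W = M(K)], each
    [w] being hit [#|H|] times for [H] the common kernel of [L] and [M]. Since
    [#|H|] is the degree of [gcdp L M], the ratio [#|K| / #|H|] is [p ^ e].

    It remains to bound an inner sum [g a] of [eta] over a coset [a + W] by
    the square root of [q = #|F|], which is [mult_char_subgroup_sum]. Instead of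
    Gauss sums, a second moment does it. The shifts of [eta] are almost
    orthogonal ([mult_char_correlation]), so the sum of [`|g b| ^ 2] over all [b]
    is [q #|W| - #|W| ^ 2]; as [g] is constant on cosets of [W], this total
    contains [#|W|] copies of [`|g a| ^ 2], whence [`|g a| ^ 2 <= q].

    Altogether the sum is at most [p ^ (n - e)] times the square root of
    [p ^ n] ([character_sum_bound]). The other case of the minimum is the
    triangle inequality. *)

(** * Additive maps, subgroups and linearized polynomials *)

Lemma zmod_closed_addl (V : zmodType) (W : {pred V}) w x :
  zmod_closed W -> w \in W -> (w + x \in W) = (x \in W).
Proof.
move=> [W0 WB] Ww.
have WN y : y \in W -> - y \in W by move=> Wy; rewrite -sub0r WB.
apply/idP/idP => Wx; last by rewrite -[x]opprK WB ?WN.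
by rewrite -(addKr w x) addrC WB.
Qed.

Section ZmodMorphism.
Variables (V U : zmodType) (h : V -> U).
Hypothesis hB : zmod_morphism h.

Lemma zmod_morph0 : h 0 = 0.
Proof. by rewrite -(subrr 0) hB !subrr. Qed.

Lemma zmod_morphD x y : h (x + y) = h x + h y.
Proof. by apply: (addIr (- h y)); rewrite addrK -hB addrK. Qed.

End ZmodMorphism.

(** The fibres of [h] on [K] are cosets of its kernel, so each value of [h] is
    taken equally often. *)
Lemma sum_over_additive_image (V : finZmodType) (U : finZmodType) (C : pzRingType)
    (h : V -> U) (K : {set V}) (g : U -> C) :
    zmod_morphism h -> zmod_closed K ->
  \sum_(z in K) g (h z) =
    #|[set z in K | h z == 0]|%:R * \sum_(w in h @: K) g w.
Proof.
move=> hB K_closed; rewrite (partition_big_imset h) mulr_sumr.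
apply: eq_bigr => _ /imsetP[z0 Kz0 ->].
rewrite (eq_bigr (fun=> g (h z0))) => [|z /andP[_ /eqP-> //]].
rewrite sumr_const -[LHS]mulr_natl; congr (_%:R * _).
(* Translation by [z0] maps the kernel onto the fibre of [h z0]. *)
rewrite -!sum1_card [LHS](reindex_inj (addIr z0)) /=; apply: eq_bigl => z.
rewrite !inE [LHS]unfold_in (zmod_morphD hB) -subr_eq0 addrK; congr (_ && _).
by rewrite addrC zmod_closed_addl.
Qed.

(** Each power [p ^ i] of the characteristic gives an additive map
    [x |-> x ^+ (p ^ i)], an iterate of the Frobenius map. *)
Lemma linearized_zmod_morphism (F : finFieldType) (p : nat) (A : {poly F}) :
  p \in [pchar F] -> linearized p A -> zmod_morphism (horner A).
Proof.
move=> charF [m [a ->]] x y /=.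
rewrite !horner_sum -sumrB; apply: eq_bigr => i _.
rewrite !hornerE -mulrBr; congr (_ * _).
have pi : [pchar F].-nat (p ^ i)%N.
  by rewrite pnatX (eq_pnat _ (pcharf_eq charF)) pnat_id ?orbT ?(pcharf_prime charF).
by apply: (addIr (y ^+ (p ^ i))); rewrite subrK -exprDn_pchar // subrK.
Qed.

(** The polynomial ['X^#|F| - 'X] is the product of all the ['X - x], so its
    divisors split into distinct linear factors. *)
Lemma card_roots_dvd_XqX (F : finFieldType) (D : {poly F}) :
  D %| 'X^#|F| - 'X -> #|[set x | root D x]| = (size D).-1.
Proof.
rewrite finField_genPoly => /dvdp_prod_XsubC[m eqD].
rewrite (eqp_size eqD) size_prod_XsubC /=.
set s := mask _ _ in eqD *.
have uniq_s : uniq s by rewrite mask_uniq // index_enum_uniq.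
rewrite -(card_uniqP uniq_s); apply: eq_card => x.
by rewrite !inE (eqp_root eqD) root_prod_XsubC.
Qed.

(** * Multiplicative characters *)

Section Characters.
Variables (F : finFieldType) (C : numClosedFieldType) (eta : F -> C).
Hypothesis eta_char : nontrivial_mult_char eta.

Lemma mult_char0 : eta 0 = 0.
Proof. by case: eta_char. Qed.

Lemma mult_charM x y : eta (x * y) = eta x * eta y.
Proof.
have [eta0 _ etaM _] := eta_char.
have [->|x0] := eqVneq x 0; first by rewrite !mul0r eta0 mul0r.
have [->|y0] := eqVneq y 0; first by rewrite !mulr0 eta0 mulr0.
exact: etaM.
Qed.

Lemma mult_char1 : eta 1 = 1.
Proof.
have [_ eta_neq0 _ _] := eta_char.
apply: (mulfI (eta_neq0 1 (oner_neq0 F))).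
by rewrite -mult_charM !mulr1.
Qed.

Lemma mult_charX x m : eta (x ^+ m) = eta x ^+ m.
Proof.
elim: m => [|m IHm]; first by rewrite !expr0 mult_char1.
by rewrite !exprS mult_charM IHm.
Qed.

(** A nonzero [x] is a root of unity, hence so is its image. *)
Lemma mult_char_norm x : x != 0 -> `|eta x| = 1.
Proof.
move=> x0; apply/eqP.
have F_gt1 : (1 < #|F|)%N by rewrite (cardD1 0) (cardD1 1) !inE oner_neq0.
have m_gt0 : (0 < #|F|.-1)%N by rewrite -ltnS prednK // ltnW.
have xm : x ^+ #|F|.-1 = 1.
  by apply: (mulfI x0); rewrite -exprS prednK ?(ltnW F_gt1) // expf_card mulr1.
by rewrite -(pexpr_eq1 m_gt0) // -normrX -mult_charX xm mult_char1 normr1.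
Qed.

Lemma mult_char_norm_le1 x : `|eta x| <= 1.
Proof.
have [->|x0] := eqVneq x 0; first by rewrite mult_char0 normr0 ler01.
by rewrite mult_char_norm.
Qed.

(** Multiplying the argument by some [y] with [eta y != 1] permutes the terms
    and multiplies the sum by [eta y]. *)
Lemma mult_char_sum0 : \sum_x eta x = 0.
Proof.
have [_ _ _ [y y0 eta_y]] := eta_char.
have sum_fixed : \sum_x eta x = eta y * \sum_x eta x.
  rewrite {1}(reindex_inj (mulfI y0)) /= mulr_sumr.
  by apply: eq_bigr => x _; rewrite mult_charM.
apply/eqP; move/eqP: sum_fixed.
by rewrite -{1}[\sum_x eta x]mul1r -subr_eq0 -mulrBl mulf_eq0 subr_eq0 eq_sym
           (negPf eta_y).
Qed.

(** The shifts of a nontrivial character are almost orthogonal. For [d != 0]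
    the summand is [eta (1 + d / x)] whenever [x != 0], and [1 + d / x] then
    takes every value except [1] exactly once. *)
Lemma mult_char_correlation d :
  \sum_x eta (x + d) * (eta x)^* = #|F|%:R *+ (d == 0) - 1.
Proof.
rewrite (bigD1 0) //= mult_char0 conjC0 mulr0 add0r.
have [->|d0] := eqVneq d 0.
  rewrite (eq_bigr (fun=> 1)) => [|x x0]; last first.
    by rewrite addr0 -normCK mult_char_norm // expr1n.
  by rewrite sumr_const cardC1 -subn1 natrB // (cardD1 0).
rewrite mulr0n sub0r.
have ratio x : x != 0 -> eta (x + d) * (eta x)^* = eta (1 + d * x^-1).
  move=> x0; have -> : x + d = (1 + d * x^-1) * x by rewrite mulrDl mul1r divfK.
  by rewrite mult_charM -mulrA -normCK mult_char_norm // expr1n mulr1.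
rewrite (eq_bigr _ ratio) (reindex_inj invr_inj) /=.
rewrite (reindex_inj (mulfI (invr_neq0 d0))) /=.
transitivity (\sum_(x | x != 0) eta (1 + x)).
  apply: eq_big => [x|x _]; last by rewrite invrK mulVKf.
  by rewrite invr_eq0 mulf_eq0 invr_eq0 (negPf d0).
have := mult_char_sum0; rewrite (reindex_inj (addrI 1)) /= (bigD1 0) //=.
by rewrite addr0 mult_char1 => /eqP; rewrite addrC addr_eq0 => /eqP.
Qed.

(** The squares of the norms of all translates of the sum add up to
    [#|F| * #|W| - #|W| ^ 2], by almost orthogonality; translates by elements
    of [W] are equal, so [#|W|] of these squares are the one in question. *)
Lemma mult_char_subgroup_sum (W : {set F}) a :
  zmod_closed W -> `|\sum_(w in W) eta (a + w)| ^+ 2 <= #|F|%:R.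
Proof.
move=> W_closed; pose g b := \sum_(w in W) eta (b + w).
have g_periodic w b : w \in W -> g (b + w) = g b.
  move=> Ww; rewrite /g [RHS](reindex_inj (addrI w)) /=.
  by apply: eq_big => [x|x _]; rewrite ?zmod_closed_addl ?addrA.
have W_gt0 : (0 < #|W|)%N by apply/card_gt0P; exists 0; case: W_closed.
have second_moment : \sum_b `|g b| ^+ 2 = #|F|%:R * #|W|%:R - #|W|%:R ^+ 2.
  transitivity (\sum_(w in W) \sum_(v in W) \sum_b eta (b + w) * (eta (b + v))^*).
    under eq_bigr => b _ do rewrite normCK /g rmorph_sum mulr_suml.
    rewrite exchange_big; apply: eq_bigr => w _ /=.
    under eq_bigr => b _ do rewrite mulr_sumr.
    by rewrite exchange_big.
  transitivity (\sum_(w in W) (#|F|%:R - #|W|%:R : C)); last first.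
    by rewrite sumr_const -[LHS]mulr_natr mulrBl expr2.
  apply: eq_bigr => w Ww.
  transitivity (\sum_(v in W) (#|F|%:R *+ (w - v == 0) - 1 : C)).
    apply: eq_bigr => v _; rewrite -mult_char_correlation.
    rewrite [RHS](reindex_inj (addIr v)) /=; apply: eq_bigr => b _.
    by rewrite -addrA [v + _]addrC subrK.
  rewrite big_split /= sumrN sumr_const; congr (_ - _).
  rewrite (bigD1 w) //= subrr eqxx mulr1n big1 ?addr0 // => v /andP[_ vw].
  by rewrite subr_eq0 eq_sym (negPf vw).
have cosets : #|W|%:R * `|g a| ^+ 2 <= \sum_b `|g b| ^+ 2.
  rewrite (reindex_inj (addrI a)) /= (bigID (mem W)) /=.
  rewrite (eq_bigr (fun=> `|g a| ^+ 2)) => [|w Ww]; last by rewrite g_periodic.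
  by rewrite sumr_const mulr_natl lerDl sumr_ge0 // => b _; rewrite exprn_ge0.
rewrite -(ler_pM2l (_ : 0 < #|W|%:R)) ?ltr0n //; apply: le_trans cosets _.
by rewrite second_moment mulrC gerBl exprn_ge0.
Qed.

End Characters.

(** * The character sum *)

(** Clearing the denominator avoids real exponents: with [r = p ^ e] and
    [#|F| = p ^ n] the right-hand side is [p ^ (3 n / 2)]. *)
Lemma character_sum_bound (F : finFieldType) (C : numClosedFieldType)
    (eta : F -> C) (f L M : {poly F}) (p r : nat) :
    nontrivial_mult_char eta -> p \in [pchar F] ->
    linearized p L -> linearized p M -> L %| 'X^#|F| - 'X ->
    (r * (size (gcdp L M)).-1)%N = (size L).-1 ->
  r%:R * `|\sum_x eta (f \Po L + M).[x]| <= #|F|%:R * sqrtC #|F|%:R.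
Proof.
move=> eta_char charF L_lin M_lin L_dvd r_def.
set P := f \Po L + M; set S := \sum_x _.
have LB := linearized_zmod_morphism charF L_lin.
have MB := linearized_zmod_morphism charF M_lin.
pose K : {set F} := [set x | root L x].
have K_closed : zmod_closed K.
  split=> [|x y]; rewrite !inE /root ?(zmod_morph0 LB) //.
  by move=> /eqP Lx /eqP Ly; rewrite LB Lx Ly subrr.
pose H : {set F} := [set z in K | M.[z] == 0].
have cardH : #|H| = (size (gcdp L M)).-1.
  rewrite -(card_roots_dvd_XqX (dvdp_trans (dvdp_gcdl L M) L_dvd)).
  by apply: eq_card => x; rewrite !inE root_gcd.
have H_gt0 : (0 < #|H|)%N.
  by apply/card_gt0P; exists 0; rewrite !inE /root (zmod_morph0 LB) (zmod_morph0 MB) eqxx.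
have cardK : #|K| = (r * #|H|)%N by rewrite cardH r_def card_roots_dvd_XqX.
pose W : {set F} := [set M.[z] | z in K].
have W_closed : zmod_closed W.
  have [K0 KB] := K_closed; split.
    by apply/imsetP; exists 0; rewrite ?(zmod_morph0 MB).
  move=> _ _ /imsetP[x Kx ->] /imsetP[y Ky ->].
  by apply/imsetP; exists (x - y); rewrite ?MB ?KB.
have P_shift x z : z \in K -> P.[x + z] = P.[x] + M.[z].
  rewrite inE => /eqP Lz.
  by rewrite !hornerD !horner_comp (zmod_morphD LB) (zmod_morphD MB) Lz addr0 addrA.
(* Every [z \in K] contributes the same sum [S], by the translation
   [x |-> x + z]. *)
have averaged : #|K|%:R * S = #|H|%:R * \sum_x \sum_(w in W) eta (P.[x] + w).
  transitivity (\sum_(z in K) \sum_x eta (P.[x] + M.[z])).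
    rewrite mulr_natl -sumr_const; apply: eq_bigr => z Kz.
    by rewrite /S (reindex_inj (addIr z)); apply: eq_bigr => x _; rewrite P_shift.
  rewrite exchange_big mulr_sumr; apply: eq_bigr => x _ /=.
  exact: (sum_over_additive_image (fun w => eta (P.[x] + w)) MB K_closed).
rewrite -(ler_pM2l (_ : 0 < #|H|%:R)) ?ltr0n // mulrA -natrM mulnC -cardK.
rewrite -{1}[_%:R]normr_nat -normrM averaged normrM normr_nat.
rewrite ler_pM2l ?ltr0n // (le_trans (ler_norm_sum _ _ _)) //.
rewrite mulr_natl -sumr_const; apply: ler_sum => x _.
rewrite -(ler_pXn2r (_ : 0 < 2)%N) ?nnegrE ?sqrtC_ge0 ?ler0n // sqrtCK.
exact: mult_char_subgroup_sum.
Qed.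

Theorem theorem4p7 (R : realType) (p n : nat) (F : finFieldType)
    (p_prime : prime p) (n_ge1 : (1 <= n)%N) (cardF : #|F| = (p ^ n)%N)
    (P f L M : {poly F}) (k e : nat)
    (P_index : has_additive_index P p n k)
    (P_dec : P = f \Po L + M)
    (L_lin : linearized p L) (M_lin : linearized p M)
    (ML_deg : (size M < size L)%N) (L_deg : size L = (p ^ (n - k)).+1)
    (L_monic : L \is monic) (L_dvd : L %| 'X^(p ^ n) - 'X)
    (e_def : (p ^ e * (size (gcdp L M)).-1)%N = (p ^ (n - k))%N)
    (eta : F -> R[i]) (eta_char : nontrivial_mult_char eta) :
  `| \sum_(x : F) eta P.[x] | <=
    (p%:R `^ (n%:R - e%:R + Num.min e%:R (n%:R / 2)))%:C.
Proof.
have p_gt0 : (0 < p%:R :> R) by rewrite ltr0n prime_gt0.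
have powD (x y : R) : p%:R `^ (x + y) = p%:R `^ x * p%:R `^ y.
  by apply: powRD; rewrite (gt_eqF p_gt0) implybT.
have pown m : p%:R `^ m%:R = (p ^ m)%:R :> R by rewrite powR_mulrn ?ltW // natrX.
have natC m : m%:R = (m%:R : R)%:C :> R[i] by rewrite rmorph_nat.
case: (leP (e%:R : R)) => _.
  rewrite subrK pown -natC -cardF -sum1_card natr_sum.
  apply: le_trans (ler_norm_sum _ _ _) _; apply: ler_sum => x _.
  exact: mult_char_norm_le1.
have pe_gt0 : (0 < (p ^ e)%:R :> R[i]) by rewrite ltr0n expn_gt0 prime_gt0.
have charF := card_finPcharP cardF p_prime.
rewrite -(ler_pM2l pe_gt0) P_dec.
apply: le_trans (character_sum_bound f eta_char charF L_lin M_lin _ _) _.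
- by rewrite cardF.
- by rewrite e_def L_deg.
have half : sqrtC (p ^ n)%:R = (p%:R `^ (n%:R / 2))%:C :> R[i].
  apply/eqP; rewrite -(eqrXn2 (_ : 0 < 2)%N) ?sqrtC_ge0 ?ler0n ?ler0c ?powR_ge0 //.
  rewrite sqrtCK -rmorphXn /= -powR_mulrn ?powR_ge0 // -powRrM divfK ?pnatr_eq0 //.
  by rewrite pown natC.
rewrite cardF half !natC -!pown -!rmorphM /= -!powD.
by rewrite addrA addrCA subrr addr0.
Qed.
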